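(* For every integer $n \ge 1$, $c(n) \ge n^{0.295}$.
   Context: A tournament is an orientation of a complete graph (finite and simple). A directed path $v_1 v_2 \cdots v_m$ in a tournament is hop-complete if, for every $i$ with $1 \le i \le m-2$, the edge between $v_i$ and $v_{i+2}$ is directed from $v_i$ to $v_{i+2}$ (so the path and these edges form the square of a directed path). Let $c(n)$ denote the largest integer such that every tournament with $n$ vertices has a hop-complete path on $c(n)$ vertices. *)

(* Defs.v *)
From HB Require Import structures.
From mathcomp Require Import all_boot all_order all_algebra.
From mathcomp Require Import boolp reals exp.

Set Implicit Arguments.
Unset Strict Implicit.
Unset Printing Implicit Defensive.

(* [e x y] means that the edge between [x] and [y] is directed from x to y. *)
Definition tournament (V : finType) (e : rel V) : Prop :=
  irreflexive e /\ forall x y : V, x != y -> e x y = ~~ e y x.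

(* The path [p 0, ..., p (m - 1)] on [m] vertices. *)
Definition directed_path (V : finType) (e : rel V) (m : nat) (p : 'I_m -> V) :
    Prop :=
  injective p /\ forall i j : 'I_m, j = i.+1 :> nat -> e (p i) (p j).

Definition hop_complete (V : finType) (e : rel V) (m : nat) (p : 'I_m -> V) :
    Prop :=
  directed_path e p /\ forall i j : 'I_m, j = i.+2 :> nat -> e (p i) (p j).

Definition unavoidable (n m : nat) : Prop :=
  forall (V : finType) (e : rel V), #|V| = n -> tournament e ->
    exists p : 'I_m -> V, hop_complete e p.

(* The maximum may be restricted to [m <= n] since a path on [m] vertices in an
   n-vertex tournament has [m <= n]; see [c_unavoidable] and [c_max]. *)
Definition c (n : nat) : nat := \max_(m < n.+1 | `[< unavoidable n m >]) m.

Lemma c_unavoidable (n : nat) : unavoidable n (c n).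
Proof.
have u0 : unavoidable n 0.
  move=> V e _ _.
  have p : 'I_0 -> V by case.
  by exists p; do 2?split; case.
rewrite /c; elim/big_ind: _ => // [m1 m2 h1 h2|m /asboolP //].
by rewrite /maxn; case: ifP.
Qed.

Lemma c_max (n m : nat) : unavoidable n m -> m <= c n.
Proof.
move=> um.
have lt_tournament : @tournament 'I_n (fun x y => x < y).
  split=> [x|x y]; first exact: ltnn.
  by rewrite -leqNgt ltn_neqAle => ->.
have [p [[p_inj _] _]] := um _ _ (card_ord n) lt_tournament.
have mn : m < n.+1.
  by have := leq_card p p_inj; rewrite !card_ord ltnS.
apply: (@leq_bigmax_cond _ _ (fun i : 'I_n.+1 => i : nat) (Ordinal mn)).
exact/asboolP.
Qed.

(* Main.v *)
Require Import Defs.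
From mathcomp Require Import all_boot all_order all_algebra.
From mathcomp Require Import boolp reals exp.
From mathcomp Require Import zify.

(** The exponent can be raised to 1/3: [n <= (c n) ^ 3], by strong induction on
    [n].

    Call a vertex [s] a common in-neighbour of [a] and [b] if [s] dominates
    both, and dually for common out-neighbours.  If [a] dominates [b], then a
    hop-complete path inside the common in-neighbourhood of [a] and [b],
    followed by [a], [b] and a hop-complete path inside their common
    out-neighbourhood, is again hop-complete ([hop_seq_glue]).  So it suffices
    to find a pair [a], [b] whose common neighbourhoods have sizes [X] and [Y]
    with [X * Y] of order [n ^ 2 / 36] ([exists_rich_pair]): if [u] and [v] are
    the orders of the two paths, then
      [(u + v) ^ 6 >= 64 * u ^ 3 * v ^ 3 >= 64 * X * Y],
    and for [n > 64] the right-hand side exceeds [n ^ 2] because 64 > 36.  For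
    [9 <= n <= 64] the glued path only needs four vertices, which it has as soon
    as [X] and [Y] are nonzero.

    The pair comes from double counting.  Let [m s l] be the number of paths
    [s -> a -> l].  Summing [X * Y] over all ordered pairs [(a, b)] counts the
    quadruples [(s, a, b, l)] in which [a] and [b] are both midpoints of a path
    from [s] to [l], that is the sum of [m s l ^ 2].  Every triple of vertices
    contains a path with two edges, so the [m s l] sum to at least [n] choose 3
    and have average at least about [n / 6]; by convexity their squares have
    average at least about [n ^ 2 / 36], hence so has [X * Y].  The degenerate
    pairs [a = b] only affect lower-order terms. *)

Set Implicit Arguments.
Unset Strict Implicit.
Unset Printing Implicit Defensive.

(** * Hop-complete paths as sequences *)

(** Each vertex need only dominate the next two, which makes the predicate
    structurally recursive. *)
Fixpoint hop_seq (V : eqType) (e : rel V) (s : seq V) : bool :=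
  if s is x :: s' then all (e x) (take 2 s') && hop_seq e s' else true.

Lemma hop_seq_map (V W : eqType) (f : W -> V) (e : rel V) (s : seq W) :
  hop_seq e (map f s) = hop_seq (relpre f e) s.
Proof. by elim: s => //= x s ->; rewrite -map_take all_map. Qed.

Lemma hop_seq_nth (V : eqType) (e : rel V) (s : seq V) (x0 : V) (i j : nat) :
  hop_seq e s -> i < j <= i.+2 -> j < size s -> e (nth x0 s i) (nth x0 s j).
Proof.
elim: s i j => [|x s IHs] [|i] [|j] //= /andP[es hs] ij js; last exact: IHs.
have j2 : j < size (take 2 s) by rewrite size_take; case: ifP => _; lia.
by have := all_nthP x0 es j j2; rewrite nth_take //; lia.
Qed.

Lemma hop_seq_hop_complete (V : finType) (e : rel V) (s : seq V) (x0 : V)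
    (m : nat) :
  uniq s -> hop_seq e s -> m <= size s ->
  hop_complete e (fun i : 'I_m => nth x0 s i).
Proof.
move=> us hs ms.
have ltm (i : 'I_m) : i < size s by apply: leq_trans ms.
split; last by move=> i j ij; apply: hop_seq_nth => //; lia.
split; last by move=> i j ij; apply: hop_seq_nth => //; lia.
by move=> i j /eqP; rewrite nth_uniq // => /eqP/val_inj.
Qed.

(** Two consecutive vertices suffice to separate the two paths: no edge of the
    square of the glued path joins [P] to [Q]. *)
Lemma hop_seq_glue (V : eqType) (e : rel V) (a b : V) (P Q : seq V) :
  e a b -> hop_seq e P -> hop_seq e Q ->
  all (e^~ a) P -> all (e^~ b) P -> all (e a) Q -> all (e b) Q ->
  hop_seq e (P ++ [:: a, b & Q]).
Proof.
move=> eab + hQ + + aQ bQ.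
have all_take k x : all (e x) Q -> all (e x) (take k Q).
  by rewrite -{1}(cat_take_drop k Q) all_cat => /andP[].
elim: P => [|x P IHP] /=; first by rewrite eab hQ (all_take 1) ?(all_take 2).
move=> /andP[xP hP] /andP[xa aP] /andP[xb bP]; rewrite IHP // andbT.
by case: P xP {IHP hP aP bP} => [|y [|z P]] /=; rewrite ?take0 ?xa ?xb ?andbT.
Qed.

(** * Pairs with many common in- and out-neighbours *)

Section Counting.

Variables (V : finType) (e : rel V).
Hypothesis tourn : tournament e.

Definition common_in (a b : V) : {set V} := [set s | e s a && e s b].
Definition common_out (a b : V) : {set V} := [set l | e a l && e b l].
Definition midpoints (s l : V) : nat := \sum_(a : V) (e s a && e a l).

Lemma tournament_asym (x y : V) : e x y -> e y x = false.
Proof.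
case: tourn => irr dec exy; have [xy|xy] := eqVneq x y.
  by move: exy; rewrite xy irr.
by apply: negbTE; rewrite -dec.
Qed.

Lemma midpoints_diag (s : V) : midpoints s s = 0.
Proof.
by apply: big1 => a _; case: (boolP (e s a)) => // /tournament_asym ->.
Qed.

Lemma sum_off_diag (F : V -> V -> nat) :
  \sum_x \sum_y F x y = \sum_x \sum_(y | y != x) F x y + \sum_x F x x.
Proof.
by rewrite -big_split /=; apply: eq_bigr => x _; rewrite (bigD1 x) //= addnC.
Qed.

Lemma sum_const_off_diag (k : nat) :
  \sum_(x : V) \sum_(y | y != x) k = #|V| * (#|V|.-1 * k).
Proof.
under eq_bigr => x _ do rewrite sum_nat_const cardC1.
by rewrite sum_nat_const.
Qed.

(** Among three distinct vertices some vertex is the midpoint of a path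
    through the other two; summing over the six orders of a triple counts
    each path six times. *)
Lemma sum_midpoints_ge :
  #|V| * (#|V|.-1 * #|V|.-2) <= 6 * \sum_s \sum_l midpoints s l.
Proof.
pose f x y z : nat := e x y && e y z.
have fE : \sum_s \sum_l midpoints s l = \sum_x \sum_y \sum_z f x y z.
  by apply: eq_bigr => s _; rewrite exchange_big.
have swap12 g : \sum_x \sum_y \sum_z g x y z
    = \sum_(x : V) \sum_(y : V) \sum_(z : V) (g y x z : nat).
  by rewrite exchange_big.
have swap23 g : \sum_x \sum_y \sum_z g x y z
    = \sum_(x : V) \sum_(y : V) \sum_(z : V) (g x z y : nat).
  by apply: eq_bigr => x _; rewrite exchange_big.
have -> : 6 * \sum_s \sum_l midpoints s l = \sum_x \sum_y \sum_z
    (f x y z + f x z y + f y x z + f y z x + f z x y + f z y x).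
  rewrite fE; set S := \sum_x _.
  under eq_bigr => x _ do (under eq_bigr => y _ do rewrite !big_split /=).
  under eq_bigr => x _ do rewrite !big_split /=.
  rewrite !big_split /= -(swap23 f) -(swap12 f).
  rewrite -(swap12 (fun x y z => f x z y)) -(swap23 f).
  rewrite -(swap23 (fun x y z => f y x z)) -(swap12 f).
  rewrite -(swap23 (fun x y z => f y z x)).
  rewrite -(swap12 (fun x y z => f x z y)) -(swap23 f) -/S; lia.
have -> : #|V| * (#|V|.-1 * #|V|.-2)
    = \sum_(x : V) \sum_(y | y != x) \sum_(z | (z != x) && (z != y)) 1.
  rewrite -sum_const_off_diag; apply: eq_bigr => x _; apply: eq_bigr => y yx.
  rewrite sum1_card.
  have := cardC (pred2 x y); rewrite card2 eq_sym yx.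
  rewrite (eq_card (B := predC (pred2 x y))); first by move=> <-.
  by move=> z; rewrite !inE negb_or.
apply: leq_sum => x _; rewrite [leqRHS](bigID (fun y => y != x)) /=.
apply: leq_trans (leq_addr _ _); apply: leq_sum => y yx.
rewrite [leqRHS](bigID (fun z => (z != x) && (z != y))) /=.
apply: leq_trans (leq_addr _ _); apply: leq_sum => z /andP[zx zy].
case: tourn => _ dec.
rewrite /f (dec _ _ yx) (dec _ _ zx) (dec _ _ zy).
by case: (e x y); case: (e x z); case: (e y z).
Qed.

(** Both sides count the quadruples [(s, a, b, l)] with [a] and [b] midpoints
    of paths from [s] to [l]. *)
Lemma sum_midpoints_sq :
  \sum_s \sum_l midpoints s l ^ 2
  = \sum_a \sum_b #|common_in a b| * #|common_out a b|.
Proof.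
pose g s l a b : nat := (e s a && e a l) * (e s b && e b l).
transitivity (\sum_s \sum_l \sum_a \sum_b g s l a b).
  apply: eq_bigr => s _; apply: eq_bigr => l _.
  rewrite expnS expn1 big_distrl /=; apply: eq_bigr => a _.
  by rewrite big_distrr.
under eq_bigr => s _ do rewrite exchange_big /=.
rewrite exchange_big /=; apply: eq_bigr => a _.
under eq_bigr => s _ do rewrite exchange_big /=.
rewrite exchange_big /=; apply: eq_bigr => b _.
rewrite -!sum1_card [in RHS]big_mkcond /= big_distrl /=.
apply: eq_bigr => s _; rewrite [in RHS]big_mkcond /= big_distrr /=.
apply: eq_bigr => l _; rewrite /g !inE.
by case: (e s a); case: (e s b); case: (e a l); case: (e b l).
Qed.

Lemma sum_midpoints_diag :
  \sum_s \sum_l midpoints s l = \sum_a #|common_in a a| * #|common_out a a|.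
Proof.
under eq_bigr => s _ do rewrite exchange_big /=.
rewrite exchange_big /=; apply: eq_bigr => a _.
rewrite -!sum1_card [in RHS]big_mkcond /= big_distrl /=.
apply: eq_bigr => s _; rewrite [in RHS]big_mkcond /= big_distrr /=.
by apply: eq_bigr => l _; rewrite !inE !andbb; case: (e s a); case: (e a l).
Qed.

Lemma sum_common_ge : 9 <= #|V| ->
  #|V| * (#|V|.-1 * (#|V|.-2 * (#|V| - 8)))
  <= 36 * \sum_a \sum_(b | b != a) #|common_in a b| * #|common_out a b|.
Proof.
move=> n9.
have ge := sum_midpoints_ge.
have := sum_midpoints_sq; rewrite [in RHS]sum_off_diag -sum_midpoints_diag.
have := sum_off_diag midpoints; rewrite [X in _ + X]big1 ?addn0; last first.
  by move=> s _; rewrite midpoints_diag.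
rewrite [X in X = _ + _]sum_off_diag [X in _ + X]big1 ?addn0; last first.
  by move=> s _; rewrite midpoints_diag.
(* Convexity in tangent-line form, at the value [m = (n - 2) / 6] that the
   triples predict for the average number of midpoints. *)
have tangent : 12 * #|V|.-2 * \sum_s \sum_(l | l != s) midpoints s l
    <= 36 * (\sum_s \sum_(l | l != s) midpoints s l ^ 2)
       + #|V| * (#|V|.-1 * #|V|.-2 ^ 2).
  rewrite -sum_const_off_diag !big_distrr -big_split /=.
  apply: leq_sum => s _; rewrite !big_distrr -big_split /=.
  apply: leq_sum => l _.
  have [+ _] := nat_Cauchy (6 * midpoints s l) #|V|.-2; rewrite -!mulnn.
  by move: (midpoints s l) #|V|.-2 => m N; lia.
move: tangent ge.
set W := \sum_s \sum_l midpoints s l; set Q := \sum_a \sum_(b | b != a) _ * _.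
set M2 := \sum_s \sum_(l | l != s) midpoints s l ^ 2.
move=> + ge WE QE; rewrite -WE QE => tangent.
have [k nE] : exists k, #|V| = k + 9 by exists (#|V| - 9); lia.
move: tangent ge; rewrite {}nE.
have -> : (k + 9).-1 = k + 8 by lia.
have -> : (k + 8).-1 = k + 7 by lia.
have -> : k + 9 - 8 = k + 1 by lia.
move=> tangent ge.
(* Multiply the lower bound on [W] by the coefficient [2 * (n - 2) - 6] that
   remains after removing the pairs [a = b]. *)
by move: tangent (leq_mul (leqnn (2 * k + 8)) ge); rewrite -mulnn; lia.
Qed.

Lemma exists_rich_pair : 9 <= #|V| ->
  exists2 ab : V * V, e ab.1 ab.2 &
    #|V|.-2 * (#|V| - 8)
    <= 36 * (#|common_in ab.1 ab.2| * #|common_out ab.1 ab.2|).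
Proof.
move=> n9; set K := _ * (_ - 8).
pose F a b := #|common_in a b| * #|common_out a b|.
have [a [b ba KF]] : exists a, exists2 b, b != a & K <= 36 * F a b.
  apply: contrapT => noab.
  have : 36 * \sum_a \sum_(b | b != a) F a b + #|V| * (#|V|.-1 * 1)
      <= #|V| * (#|V|.-1 * K).
    rewrite -!sum_const_off_diag big_distrr -big_split /=.
    apply: leq_sum => a _; rewrite big_distrr -big_split /=.
    apply: leq_sum => b ba; rewrite addn1 ltnNge; apply/negP => KF.
    by apply: noab; exists a; exists b.
  have pos : 0 < #|V| * (#|V|.-1 * 1) by rewrite !muln_gt0; lia.
  have le := sum_common_ge n9; rewrite -/K in le.
  move=> lt; have := leq_trans (leq_add le (leqnn _)) lt.
  by rewrite -[X in _ <= X]addn0 leq_add2l leqNgt pos.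
have [eab|] := boolP (e a b); first by exists (a, b).
case: tourn => _ dec; rewrite -dec // => eba; exists (b, a) => //=.
have -> : common_in b a = common_in a b by apply/setP => z; rewrite !inE andbC.
suff -> : common_out b a = common_out a b by [].
by apply/setP => z; rewrite !inE andbC.
Qed.

End Counting.

(** * The cubic bound *)

Lemma tournament_sub (V : finType) (A : {set V}) (e : rel V) :
  tournament e -> tournament (relpre (val : {x | x \in A} -> V) e).
Proof.
by case=> irr dec; split=> [x|x y xy] /=; [exact: irr | apply: dec].
Qed.

(** For large [n] this is [4 * u * v <= (u + v) ^ 2], cubed.  The two vertices
    of the middle pair are used only for [n <= 64], where the lower-order terms
    of [(n - 2) * (n - 8)] would spoil that estimate; there [u] and [v] are
    positive, and [4 ^ 3 = 64]. *)
Lemma cube_bound_step (n X Y u v : nat) : 9 <= n ->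
  n.-2 * (n - 8) <= 36 * (X * Y) -> X <= u ^ 3 -> Y <= v ^ 3 ->
  n <= (u + v + 2) ^ 3.
Proof.
move=> n9 XY Xu Yv.
have XYuv : X * Y <= (u * v) ^ 3 by rewrite expnMn leq_mul.
have [n64|n64] := leqP n 64.
  have uv : 0 < u * v.
    rewrite lt0n; apply/eqP => uv0; move: XYuv XY; rewrite uv0 leqn0 => /eqP->.
    by rewrite leqn0 muln_eq0; lia.
  apply: leq_trans n64 _; rewrite -[64]/(4 ^ 3) leq_exp2r //; nia.
rewrite -leq_sqr.
have amgm : 64 * (u * v) ^ 3 <= ((u + v) ^ 2) ^ 3.
  by rewrite -[64]/(4 ^ 3) -expnMn leq_exp2r // (nat_AGM2 u v).1.
have mono : ((u + v) ^ 2) ^ 3 <= ((u + v + 2) ^ 3) ^ 2.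
  by rewrite -expnM mulnC expnM -!expnM leq_exp2r // leq_addr.
apply: leq_trans mono; apply: leq_trans amgm.
have : 36 * n ^ 2 <= 64 * (n.-2 * (n - 8)).
  have [k ->] : exists k, n = k + 65 by exists (n - 65); lia.
  have -> : (k + 65).-2 = k + 63 by lia.
  have -> : k + 65 - 8 = k + 57 by lia.
  by rewrite -mulnn; nia.
lia.
Qed.

Lemma exists_hop_seq (V : finType) (e : rel V) : tournament e ->
  exists s : seq V, [/\ uniq s, hop_seq e s & #|V| <= size s ^ 3].
Proof.
have [n] := ubnP #|V|; elim: n => // n IHn in V e * => ltVn te.
have [V9|V9] := leqP 9 #|V|; last first.
  have [V2|V2] := ltnP 1 #|V|.
    have /card_gt1P[x [y [_ _ xy]]] := V2.
    wlog exy : x y xy / e x y.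
      move=> wl; have [|nexy] := boolP (e x y); first exact: wl.
      by apply: (wl y x); [rewrite eq_sym | rewrite te.2 // eq_sym].
    by exists [:: x; y]; rewrite /= inE xy exy.
  case: (leqP #|V| 0) => [V0|/card_gt0P[x _]]; first by exists [::]; split=> //; lia.
  by exists [:: x].
have [[a b] /= eab XY] := exists_rich_pair te V9.
have asym := tournament_asym te.
have eaa x : e x x = false by case: te.
have sub (A : {set V}) : a \notin A -> exists s : seq V,
    [/\ uniq s, hop_seq e s, {subset s <= A} & #|A| <= size s ^ 3].
  move=> aA.
  have cardA : #|{: {x | x \in A}}| = #|A| by rewrite card_sig; apply: eq_card.
  have ltAn : #|{: {x | x \in A}}| < n.
    rewrite cardA; have := max_card [predU1 a & A].
    by rewrite cardU1 aA; lia.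
  have [s [us hs cs]] := IHn _ _ ltAn (tournament_sub A te).
  exists (map val s); rewrite hop_seq_map size_map -cardA map_inj_uniq //.
    by split=> // _ /mapP[x _ ->]; exact: valP.
  exact: val_inj.
have [|P [uP hP subP cP]] := sub (common_in e a b); first by rewrite inE eaa.
have [|Q [uQ hQ subQ cQ]] := sub (common_out e a b); first by rewrite inE eaa.
exists (P ++ [:: a, b & Q]); split.
- have nP x : ~~ (e x a && e x b) -> x \notin P.
    by apply: contra => /subP; rewrite inE.
  have nQ x : ~~ (e a x && e b x) -> x \notin Q.
    by apply: contra => /subQ; rewrite inE.
  have -> : uniq (P ++ [:: a, b & Q]) =
      [&& a \notin P, b \notin P, ~~ has [in P] Q, a != b, a \notin Q
        & b \notin Q].
    by rewrite cat_uniq uP /= uQ !inE !negb_or andbT -!andbA.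
  rewrite !nP ?nQ ?eaa ?andbF //=; apply/andP; split.
    by apply/hasPn => x /subQ; rewrite inE => /andP[/asym xa _]; rewrite nP ?xa.
  by rewrite andbT; apply: contraTneq eab => ->; rewrite eaa.
- apply: hop_seq_glue => //; apply/allP => x.
  + by move/subP; rewrite inE => /andP[].
  + by move/subP; rewrite inE => /andP[].
  + by move/subQ; rewrite inE => /andP[].
  + by move/subQ; rewrite inE => /andP[].
- have -> : size (P ++ [:: a, b & Q]) = size P + size Q + 2.
    by rewrite size_cat /=; lia.
  exact: cube_bound_step V9 XY cP cQ.
Qed.

Lemma leq_c_cube (n : nat) : n <= c n ^ 3.
Proof.
rewrite leqNgt; apply/negP => cn.
suff /c_max : unavoidable n (c n).+1 by rewrite ltnn.
move=> V e Vn te; have [s [us hs cs]] := exists_hop_seq te.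
have ltcs : c n < size s.
  by rewrite -(@ltn_exp2r _ _ 3) // (leq_trans _ cs) // Vn.
have /card_gt0P[x0 _] : 0 < #|V| by rewrite Vn (leq_ltn_trans _ cn).
by exists (fun i => nth x0 s i); apply: hop_seq_hop_complete.
Qed.

Local Open Scope ring_scope.
Import Order.TTheory GRing.Theory Num.Theory.

Theorem theorem1p2 (R : realType) (n : nat) (hn : (1 <= n)%N) :
  (n%:R : R) `^ (295 / 1000) <= (c n)%:R.
Proof.
have n1 : 1 <= n%:R :> R by rewrite ler1n.
have le_third : 295 / 1000 <= 3^-1 :> R.
  by rewrite ler_pdivrMr ?ltr0n // ler_pdivlMl ?ltr0n // -!natrM ler_nat.
apply: le_trans (ler_powR n1 le_third) _.
have -> : (c n)%:R = ((c n)%:R ^+ 3) `^ 3^-1 :> R.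
  by rewrite -powR_mulrn // -powRrM mulfV ?pnatr_eq0 // powRr1.
apply: ge0_ler_powR; rewrite ?nnegrE ?invr_ge0 ?exprn_ge0 //.
by rewrite -natrX ler_nat leq_c_cube.
Qed.
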